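(* Let $G$ be a countable amenable group, and let $M=(\mu_n)_{n=1}^\infty$ be a sequence of almost-invariant probability measures on $G$. Then the following hold. (1) If $\textup{dc}_M(G)>\frac{5}{8}$ then $G$ is abelian. (2) If $\textup{dc}_M(G)\ge\frac{1}{2}+\varepsilon$ for some $\varepsilon>0$ then the centre of $G$ has index at most $\frac{1}{\varepsilon}$ in $G$. (3) There is an absolute constant $C>0$ such that if $G$ is finitely generated and $\textup{dc}_M(G)\ge\alpha>0$ then $G$ has a normal subgroup $\Gamma$ of index at most $\lceil\alpha^{-1}\rceil$ and a normal subgroup $H$ of cardinality at most $\exp(C\alpha^{-C})$ such that $H\subset\Gamma$ and $\Gamma/H$ is abelian.
   Context: A sequence $(\mu_n)$ of probability measures on $G$ is almost-invariant if $\|x\cdot\mu_n-\mu_n\|_1\to0$ for every $x\in G$, where $x\cdot\mu(A)=\mu(x^{-1}A)$. For a probability measure $\nu$ on $G$, $\textup{dc}_\nu(G)=(\nu\times\nu)(\{(x,y)\in G\times G:xy=yx\})$, and $\textup{dc}_M(G)=\limsup_{n\to\infty}\textup{dc}_{\mu_n}(G)$. *)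

(* Defs.v *)
From HB Require Import structures.
From mathcomp Require Import all_boot all_order all_algebra.
From mathcomp Require Import all_classical all_reals all_analysis.
Set Implicit Arguments. Unset Strict Implicit. Unset Printing Implicit Defensive.
Import Order.TTheory GRing.Theory Num.Theory.
Local Open Scope classical_set_scope.
Local Open Scope ring_scope.

Section Defs.
Variable R : realType.
Variable G : groupType.

(* A probability measure on the countable discrete group G (all subsets
   measurable), represented by its mass function. *)
Definition is_prob (mu : G -> R) : Prop :=
  (forall g, 0 <= mu g) /\ (\esum_(g in [set: G]) (mu g)%:E = 1%:E)%E.

(* (x . mu)(A) = mu(x^-1 A), i.e. mass function g |-> mu (x^-1 g). *)
Definition translate (x : G) (mu : G -> R) : G -> R :=
  fun g => mu (x^-1 * g)%g.

(* l^1 distance (total variation norm of the signed measure mu - nu). *)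
Definition l1dist (mu nu : G -> R) : \bar R :=
  (\esum_(g in [set: G]) `|mu g - nu g|%:E)%E.

Definition almost_invariant (mu : nat -> G -> R) : Prop :=
  (forall n, is_prob (mu n)) /\
  forall x : G, (fun n => l1dist (translate x (mu n)) (mu n)) @ \oo --> 0%E.

Definition dc (nu : G -> R) : \bar R :=
  (\esum_(p in [set p : G * G | (p.1 * p.2 = p.2 * p.1)%g]) (nu p.1 * nu p.2)%:E)%E.

Definition dcM (mu : nat -> G -> R) : \bar R := limn_esup (fun n => dc (mu n)).

Definition amenable : Prop :=
  exists m : set G -> R,
    (forall A, 0 <= m A) /\ m [set: G] = 1 /\
    (forall A B, A `&` B = set0 -> m (A `|` B) = m A + m B) /\
    (forall (x : G) (A : set G), m [set (x * a)%g | a in A] = m A).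

Definition grp_abelian : Prop := forall x y : G, (x * y = y * x)%g.

Definition centre : set G := [set z | forall x : G, (z * x = x * z)%g].

Definition is_subgroup (H : set G) : Prop :=
  H 1%g /\ (forall x y, H x -> H y -> H (x * y)%g) /\ (forall x, H x -> H x^-1%g).

Definition is_normal (H : set G) : Prop :=
  is_subgroup H /\ forall g h, H h -> H (g^-1 * h * g)%g.

Definition index_le (H : set G) (k : nat) : Prop :=
  exists s : seq G, (size s <= k)%N /\
    forall x : G, exists2 g, g \in s & H (g^-1 * x)%g.

Definition finite_card_le (H : set G) (N : R) : Prop :=
  exists s : seq G, H `<=` [set x | x \in s] /\ (size s)%:R <= N.

Definition finitely_generated : Prop :=
  exists s : seq G, forall x : G,
    forall H, is_subgroup H -> [set y | y \in s] `<=` H -> H x.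

(* Gamma / H is abelian (for H normal, H subset of Gamma) *)
Definition quotient_abelian (Gamma H : set G) : Prop :=
  forall x y, Gamma x -> Gamma y -> H (x^-1 * y^-1 * x * y)%g.

End Defs.

(* Main.v *)
(* All three parts bound commuting probabilities through disjoint translates: if
   [k] translates of a set [A] by fixed group elements are disjoint, then
   almost-invariance forces [mu_n A <= 1/k + o(1)].

   For (1) and (2): if [x] does not commute with [f] then [C(x)] and [f C(x)] are
   disjoint, so [C(x)] has mass at most [1/2 + o(1)] uniformly over [x] outside
   the centralizer of a fixed finite set [F], and that centralizer has mass about
   at most [1/m] once [F] separates [m] cosets of the centre.

   For (3): let [N] be the ceiling of [1/alpha], [K = 2 N (N+1)] and [X] the set
   of elements with at most [K] conjugates.  Finite generation makes the mass of
   [C(x)] uniformly at most about [1/K] for [x] outside [X], so [X] has mass more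
   than [1/(N+1)].  Hence at most [N] translates of [X] are disjoint, which gives
   [<X> = X^(3N) = Gamma] and index at most [N].  To bound [Gamma'], take [a] in
   [Gamma] with a class of maximal size.  An element [u] commuting with a suitable
   finite set satisfies [class (u a) = u * class a] by maximality, and this puts
   [[u, g]] into [<Y>'], where [Y] is a conjugation-closed subset of [X] of size
   [q] polynomial in [N]; in fact [Gamma' = <Y>'].  Finally [<Y>'] has at most
   [(q!)^q] elements: every [y^(q!)] with [y] in [Y] is central in [<Y>], and a
   collection process brings words in [Y] to sorted form with exponents below
   [q!]; for commutators the central factors removed on the way are determined by
   the exponents, because the total exponent over each class is zero. *)
From mathcomp Require Import all_boot all_order all_algebra fingroup perm cyclic.
From mathcomp Require Import all_classical all_reals all_analysis.
From mathcomp Require Import zify ring lra.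
Require Import Defs.
Set Implicit Arguments. Unset Strict Implicit. Unset Printing Implicit Defensive.
Import Order.TTheory GRing.Theory Num.Theory.
Local Open Scope classical_set_scope.
Local Open Scope ring_scope.

(** * Commutator subgroup of a group generated by a finite normal set *)

Definition gen_subgroup (G : groupType) (S : set G) : set G :=
  [set g | forall H, is_subgroup H -> S `<=` H -> H g].

Lemma gen_subgroup_subgroup (G : groupType) (S : set G) : is_subgroup (gen_subgroup S).
Proof.
split; first by move=> H [].
by split=> [x y Sx Sy|x Sx] H HH SH; have [_ [HM HV]] := HH;
  [apply: HM; [exact: Sx|exact: Sy]|apply: HV; exact: Sx].
Qed.

Lemma sub_gen_subgroup (G : groupType) (S : set G) : S `<=` gen_subgroup S.
Proof. by move=> x Sx H _; apply. Qed.

Lemma centralizer_of_subgroup (G : groupType) (S : set G) :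
  is_subgroup [set g : G | forall s, S s -> commute g s].
Proof.
split; first by move=> s _; exact/commute_sym/commute1.
split=> [x y Cx Cy|x Cx] s Ss.
  by apply/commute_sym/commuteM; apply/commute_sym; [exact: Cx|exact: Cy].
by apply/commute_sym/commuteV/commute_sym; exact: Cx.
Qed.

(** For a subgroup [S] this is its derived subgroup. *)
Definition commutator_products (G : groupType) (S : set G) : set G :=
  gen_subgroup [set [~ x, y]%g | x in S & y in S].

Lemma commgMl (G : groupType) (g h k : G) :
  [~ g * h, k]%g = ([~ g, k] ^ h * [~ h, k])%g.
Proof. by rewrite !commgEl !conjgE !invgM !mulgA !mulgK. Qed.

Lemma commgMl_commute (G : groupType) (g h c : G) :
  commute c g -> commute c h -> [~ g * c, h]%g = [~ g, h]%g.
Proof.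
move=> cg ch; have /commgP/eqP ch1 := ch; rewrite commgMl ch1 mulg1.
apply/conjg_fixP/commgP/commute_sym; rewrite commgEl conjgE.
by do ?[apply: commuteM|apply: commuteV].
Qed.

Section CollectionProcess.
Variables (G : groupType) (q : nat) (y : 'I_q -> G).
Hypothesis yI : injective y.
Hypothesis yJ : forall i j, exists k, y k = (y i ^ y j)%g.

Let yJb i j : exists k, y k == (y i ^ y j)%g.
Proof. by have [k yk] := yJ i j; exists k; rewrite yk. Qed.

Let conj_index j i : 'I_q := xchoose (yJb i j).

Let conj_indexE j i : y (conj_index j i) = (y i ^ y j)%g.
Proof. exact/eqP/(xchooseP (yJb i j)). Qed.

Let conj_index_inj j : injective (conj_index j).
Proof. by move=> a b /(congr1 y); rewrite !conj_indexE => /conjg_inj/yI. Qed.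

Let E := q`!.
Let E_gt0 : (0 < E)%N. Proof. exact: fact_gt0. Qed.

Let central (g : G) := forall i, commute g (y i).

Let z i : G := (y i ^+ E)%g.

(** Conjugation by [y i] permutes the [q] letters, and every permutation of [q] letters becomes
    trivial when raised to the power [q!]. *)
Let zC i : central (z i).
Proof.
move=> j; apply/commute_sym/commgP; rewrite -conjg_fix; apply/eqP.
have yX k : (y j ^ (y i ^+ k) = y ((perm (@conj_index_inj i) ^+ k) j))%g.
  elim: k => [|k IHk]; first by rewrite !expg0 perm1 conjg1.
  by rewrite !expgSr conjgM IHk permM permE conj_indexE.
have sE (s : {perm 'I_q}) : (s ^+ E = 1)%g.
  by have := expg_cardG (finset.in_setT s); rewrite cardsT card_Sn.
by rewrite /z yX sE perm1.
Qed.

(** Since [z i] is central, conjugate letters share it; this is why letters are counted below by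
    their value of [z]. *)
Let zJ i j : z (conj_index j i) = z i.
Proof. by rewrite /z conj_indexE -conjXg; apply/conjg_fixP/commgP/zC. Qed.

Let word := seq 'I_q.
Let eval (w : word) : G := foldr (fun l g => y l * g)%g 1%g w.

Let eval_cat w w' : eval (w ++ w') = (eval w * eval w')%g.
Proof. by elim: w => [|l w IHw] /=; rewrite ?mul1g// IHw mulgA. Qed.

Let eval_nseq k i : eval (nseq k i) = (y i ^+ k)%g.
Proof. by elim: k => [|k IHk] //=; rewrite IHk expgS. Qed.

Let centralM g h : central g -> central h -> central (g * h)%g.
Proof.
move=> Cg Ch i; apply/commute_sym/commuteM; apply/commute_sym.
- exact: Cg.
- exact: Ch.
Qed.

Let centralV g : central g -> central g^-1%g.
Proof. by move=> Cg i; apply/commute_sym/commuteV/commute_sym. Qed.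

Let central1 : central 1%g.
Proof. by move=> i; apply/commute_sym/commute1. Qed.

Let centralX g k : central g -> central (g ^+ k)%g.
Proof. by move=> Cg i; apply/commute_sym/commuteX/commute_sym. Qed.

Let central_eval g w : central g -> commute g (eval w).
Proof.
move=> Cg; elim: w => [|l w IHw] /=; first exact: commute1.
by apply: commuteM.
Qed.

Let zvals := undup [seq z i | i <- enum 'I_q].

Let zprod (f : G -> nat) : G := foldr (fun c g => c ^+ f c * g)%g 1%g zvals.

Let zvalsC c : c \in zvals -> central c.
Proof. by rewrite mem_undup => /mapP[i _ ->]; exact: zC. Qed.

Let zprodC f : central (zprod f).
Proof.
rewrite /zprod; elim: zvals zvalsC => [|c s IHs] //= sC.
apply: centralM; first by apply/centralX/sC; rewrite mem_head.
by apply: IHs => d ds; apply: sC; rewrite inE ds orbT.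
Qed.

Let central_z g i : central g -> commute g (z i).
Proof. by move=> Cg; apply/commuteX/Cg. Qed.

Let central_zval g c : central g -> c \in zvals -> commute g c.
Proof. by move=> Cg; rewrite mem_undup => /mapP[i _ ->]; exact: central_z. Qed.

Let central_zprod g f : central g -> commute g (zprod f).
Proof.
move=> Cg; rewrite /zprod.
elim: zvals (fun c => @central_zval g c Cg) => [|c s IHs] sz /=; first exact: commute1.
apply: commuteM; first by apply/commuteX/sz; rewrite mem_head.
by apply: IHs => d ds; apply: sz; rewrite inE ds orbT.
Qed.

Let zprodD f g : zprod (fun c => f c + g c)%N = (zprod f * zprod g)%g.
Proof.
rewrite /zprod.
(* The trivial inclusion is carried through the induction, so that every tail still consists of
   central elements. *)
have: {subset zvals <= zvals} by [].
elim: {1 3 4 5}zvals => [|c s IHs] /= sz; first by rewrite mul1g.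
have cz : c \in zvals by apply: sz; rewrite mem_head.
have {}sz : {subset s <= zvals} by move=> d ds; apply: sz; rewrite inE ds orbT.
rewrite IHs// expgD -!mulgA; congr (_ * _)%g; rewrite !mulgA; congr (_ * _)%g.
apply/commute_sym/commuteX.
elim: s sz {IHs} => [|d s IHs] sz /=; first exact/commute_sym/commute1.
apply/commute_sym/commuteM.
  by apply/commuteX/central_zval; [exact: zvalsC|apply: sz; rewrite mem_head].
by apply/commute_sym/IHs => e es; apply: sz; rewrite inE es orbT.
Qed.

Let eq_zprod f g : f =1 g -> zprod f = zprod g.
Proof. by move=> fg; rewrite /zprod; congr foldr; apply/funext => c; rewrite fg. Qed.

Let zprod1 i : zprod (fun c => z i == c) = z i.
Proof.
rewrite /zprod.
have: uniq zvals by exact: undup_uniq.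
have: z i \in zvals by rewrite mem_undup map_f ?mem_enum.
elim: zvals => [|c s IHs] //=; rewrite inE => /orP[/eqP <-|zs] /andP[cs us].
  rewrite eqxx expg1 -[RHS]mulg1; congr (_ * _)%g.
  elim: s cs {us IHs} => [|d s IHs] //=; rewrite inE negb_or => /andP[/negbTE ->].
  by move=> /IHs ->; rewrite expg0 mul1g.
rewrite IHs//; have -> : (z i == c) = false.
  by apply: contraNF cs => /eqP <-.
by rewrite expg0 mul1g.
Qed.

Let cnt (w : word) (c : G) := count (fun l => z l == c) w.

(** Words have no inverse letters: [y l ^+ E.-1] stands for the inverse of [y l], up to the central
    factor [z l]. *)
Let inv_word (w : word) : word := flatten [seq nseq E.-1 l | l <- rev w].

Let inv_word_cons l w : inv_word (l :: w) = inv_word w ++ nseq E.-1 l.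
Proof. by rewrite /inv_word rev_cons map_rcons flatten_rcons. Qed.

Let eval_inv w : (eval w * eval (inv_word w))%g = zprod (cnt w).
Proof.
elim: w => [|l w IHw].
  rewrite /inv_word/= mulg1 /zprod; elim: zvals => //= c s <-.
  by rewrite expg0 mulg1.
rewrite inv_word_cons eval_cat eval_nseq /= -!mulgA (mulgA (eval w)) IHw.
rewrite (@eq_zprod (cnt (l :: w)) (fun c => (z l == c) + cnt w c)%N)// zprodD zprod1.
rewrite (commuteX E.-1 (zprodC (cnt w) l)) mulgA -expgS prednK//.
Qed.

Let cnt_inv w c : cnt (inv_word w) c = (E.-1 * cnt w c)%N.
Proof.
elim: w => [|l w IHw]; first by rewrite /= muln0.
rewrite inv_word_cons /cnt count_cat -/(cnt _ _) IHw count_nseq/= -/(cnt _ _).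
by rewrite mulnDr addnC mulnC.
Qed.

(* A word whose letter counts over each value [c] of [z] are multiples of [E]
   represents its evaluation divided by the corresponding product of the
   central elements [c]. *)
Let balanced (w : word) := forall c, (E %| cnt w c)%N.

Let represents (w : word) (h : G) :=
  balanced w /\ (h * zprod (fun c => cnt w c %/ E)%N)%g = eval w.

Let cnt_cat w w' c : cnt (w ++ w') c = (cnt w c + cnt w' c)%N.
Proof. exact: count_cat. Qed.

Let representsM w w' h h' :
  represents w h -> represents w' h' -> represents (w ++ w') (h * h')%g.
Proof.
move=> [Bw hw] [Bw' hw']; split; first by move=> c; rewrite cnt_cat dvdn_add.
rewrite eval_cat -hw -hw'.
rewrite (@eq_zprod _ (fun c => cnt w c %/ E + cnt w' c %/ E)%N); last first.
  by move=> c; rewrite cnt_cat divnDl.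
rewrite zprodD -!mulgA; congr (_ * _)%g; rewrite !mulgA; congr (_ * _)%g.
have -> : h' = (eval w' * (zprod (fun c => cnt w' c %/ E)%N)^-1)%g by rewrite -hw' mulgK.
apply/commute_sym/commuteM; first exact: central_eval.
exact/commuteV/central_zprod/zprodC.
Qed.

Let generated_word g : gen_subgroup (range y) g ->
  exists w c, central c /\ (g * c)%g = eval w.
Proof.
move/(_ [set g | exists w c, central c /\ (g * c)%g = eval w]); apply.
- split; first by exists [::], 1%g; split=> //; rewrite mulg1.
  split=> [a b [w [c [Cc ac]]] [w' [c' [Cc' bc]]]|a [w [c [Cc ac]]]].
    exists (w ++ w'), (c' * c)%g; split; first exact: centralM.
    rewrite eval_cat -ac -!mulgA; congr (_ * _)%g.
    by rewrite mulgA bc (central_eval w' Cc).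
  exists (inv_word w), (zprod (cnt w) * c^-1)%g; split.
    by apply: centralM; [exact: zprodC|exact: centralV].
  rewrite -eval_inv -ac.
  have := central_eval (inv_word w) (centralV Cc); rewrite /commute => cI.
  by rewrite -!mulgA -cI mulKg mulKVg.
- by move=> _ [i _ <-]; exists [:: i], 1%g; split=> //=; rewrite !mulg1.
Qed.

(** Each letter of [w] counts once in [w] and [E.-1] times in [inv_word w], so all counts are
    multiples of [E], and the quotients are exactly the central errors of the two inverse words. *)
Let represents_commg w w' :
  represents (inv_word w ++ inv_word w' ++ w ++ w') [~ eval w, eval w']%g.
Proof.
have cE c : (cnt (inv_word w ++ inv_word w' ++ w ++ w') c = (cnt w c + cnt w' c) * E)%N.
  rewrite !cnt_cat !cnt_inv -[in RHS](prednK E_gt0); lia.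
split=> [c|]; first by rewrite cE dvdn_mull.
rewrite (@eq_zprod _ (fun c => cnt w c + cnt w' c)%N); last first.
  by move=> c; rewrite cE mulnK.
rewrite zprodD !eval_cat commgEl conjgE.
have evalV u : eval (inv_word u) = ((eval u)^-1 * zprod (cnt u))%g.
  by rewrite -eval_inv mulKg.
rewrite !evalV -!mulgA; congr (_ * _)%g.
have zw u f : commute (zprod f) (eval u) by exact/central_eval/zprodC.
rewrite (mulgA (zprod (cnt w)) (eval w')^-1%g) (commuteV (zw w' _)) -!mulgA; congr (_ * _)%g.
rewrite !mulgA -[LHS]mulgA -[RHS]mulgA -eval_cat.
exact/esym/central_eval/centralM.
Qed.

Let central_generated g t : central g -> gen_subgroup (range y) t -> commute g t.
Proof.
move=> Cg /(_ [set t | forall s, [set g] s -> commute t s]) Ct; apply/commute_sym.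
apply: Ct => //; first exact: centralizer_of_subgroup.
by move=> _ [i _ <-] _ ->; apply/commute_sym.
Qed.

Let eval_generated w : gen_subgroup (range y) (eval w).
Proof.
have [g1 [gM _]] := gen_subgroup_subgroup (range y).
by elim: w => [|l w IHw] //=; apply: gM => //; apply: sub_gen_subgroup; exists l.
Qed.

Let commutator_represented h :
  commutator_products (gen_subgroup (range y)) h -> exists w, represents w h.
Proof.
have com_rep a b : gen_subgroup (range y) a -> gen_subgroup (range y) b ->
    exists w, represents w [~ a, b]%g.
  move=> ga gb; have [w [c [/centralV Cc ac]]] := generated_word ga.
  have [w' [d [/centralV Cd bd]]] := generated_word gb.
  exists (inv_word w ++ inv_word w' ++ w ++ w').
  have -> : [~ a, b]%g = [~ eval w, eval w']%g; last exact: represents_commg.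
  have -> : a = (eval w * c^-1)%g by rewrite -ac mulgK.
  rewrite commgMl_commute; try exact: central_generated.
  have -> : b = (eval w' * d^-1)%g by rewrite -bd mulgK.
  by rewrite -[LHS]invgR commgMl_commute ?invgR//; exact: central_generated.
(* A word for the inverse is carried along to make the set closed under inversion; the inverse of a
   commutator is again a commutator. *)
move=> hh; suff [w [_ [wh _]]] :
    [set h | exists w w', represents w h /\ represents w' h^-1%g] h by exists w.
apply: hh.
- have e0 : balanced [::] by move=> c; rewrite dvdn0.
  have z0 : zprod (fun c => cnt [::] c %/ E)%N = 1%g.
    rewrite /zprod; elim: zvals => //= c s ->; rewrite /= div0n expg0 mul1g//.
  split; first by exists [::], [::]; rewrite invg1; split; split; rewrite // z0 mulg1.
  split=> [a b [w [w' [wa wa']]] [v [v' [vb vb']]]|a [w [w' [wa wa']]]].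
    by exists (w ++ v), (v' ++ w'); rewrite invgM; split; exact: representsM.
  by exists w', w; rewrite invgK.
- move=> _ [a ga [b gb <-]]; have [w wab] := com_rep a b ga gb.
  by have [w' wba] := com_rep b a gb ga; exists w, w'; rewrite invgR.
Qed.

(** The first component reads [w] in base [q.+1], leading letter first, and the second is the
    length. Digits are nonzero, so codes compare lengths first and then lexicographically. *)
Let code (w : word) := foldr (fun (l : 'I_q) c => (c.1 + l.+1 * q.+1 ^ c.2, c.2.+1)%N) (0, 0)%N w.

Let code_size w : (code w).2 = size w.
Proof. by elim: w => //= l w ->. Qed.

Let code_cat u w w' : size w = size w' -> ((code w).1 < (code w').1)%N ->
  ((code (u ++ w)).1 < (code (u ++ w')).1)%N.
Proof.
move=> sw; elim: u => //= l u IHu /IHu.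
by rewrite !code_size !size_cat sw ltn_add2r.
Qed.

Let code_drop u l w : ((code (u ++ w)).1 < (code (u ++ l :: w)).1)%N.
Proof.
elim: u => [|k u IHu] /=.
  by rewrite code_size -[ltnLHS]addn0 ltn_add2l muln_gt0 expn_gt0.
by rewrite !code_size -addSn leq_add// leq_mul// leq_pexp2l// !size_cat/= leq_add2l.
Qed.

Let le_idx : rel 'I_q := relpre val leq.

Let unsorted_split (w : word) : ~~ sorted le_idx w ->
  exists u a b v, w = u ++ a :: b :: v /\ (b < a)%N.
Proof.
elim: w => [|a [|b v] IHw] //=; rewrite negb_and => /orP[|/IHw].
  by rewrite -ltnNge => ba; exists [::], a, b, v.
by move=> [u [a' [b' [v' [-> ?]]]]]; exists (a :: u), a', b', v'.
Qed.

Let le_idx_trans : transitive le_idx.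
Proof. by move=> ? ? ?; exact: leq_trans. Qed.

Let path_block i k (w : word) : path le_idx i w -> (k <= count_mem i w)%N ->
  exists v, w = nseq k i ++ v.
Proof.
case: k => [|k]; first by exists w.
elim: w k => [|b w IHw] k //=.
move=> /andP[ib pw]. have [bi|bi] := eqVneq b i.
  by rewrite bi in pw *; rewrite ltnS;
    case: k => [|k] => [_|/(IHw _ pw)[v ->]]; [exists w|exists v].
rewrite add0n => kw; have /allP bw := order_path_min le_idx_trans pw.
have /bw : i \in w by rewrite -has_pred1 has_count; apply: leq_ltn_trans kw.
rewrite /le_idx/= in ib *; move=> bi'; move: bi.
have -> : b = i; last by rewrite eqxx.
by apply/val_inj/anti_leq; rewrite /= bi' ib.
Qed.

Let sorted_block i k (w : word) : sorted le_idx w -> (k <= count_mem i w)%N ->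
  exists u v, w = u ++ nseq k i ++ v.
Proof.
case: k => [|k]; first by exists [::], w.
elim: w k => [|a w IHw] k //=.
move=> paw; have [ai|ai] := eqVneq a i.
  by rewrite ai in paw *; rewrite ltnS => /(path_block paw)[v ->]; exists [::], v.
rewrite add0n => /(IHw _ (path_sorted paw))[u [v ->]].
by exists (a :: u), v.
Qed.

(** This is [y a * y b = y b * (y a ^ y b)]; by [zJ] no count changes. *)
Let represents_swap h u a b v : represents (u ++ a :: b :: v) h ->
  represents (u ++ b :: conj_index b a :: v) h.
Proof.
have cE c : cnt (u ++ b :: conj_index b a :: v) c = cnt (u ++ a :: b :: v) c.
  by rewrite !cnt_cat /cnt/= zJ; congr addn; rewrite addnCA.
move=> [Bw hw]; split; first by move=> c; rewrite cE.
rewrite (@eq_zprod _ (fun c => cnt (u ++ a :: b :: v) c %/ E)%N); last first.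
  by move=> c; rewrite cE.
by rewrite hw !eval_cat/= conj_indexE !mulgA; congr (_ * _)%g;
  rewrite -!mulgA -conjgC.
Qed.

(** The block evaluates to [z i], and its removal lowers the quotient of the count at [z i] by
    exactly one. *)
Let represents_drop h u i v : represents (u ++ nseq E i ++ v) h ->
  represents (u ++ v) h.
Proof.
have cE c : cnt (u ++ nseq E i ++ v) c = (cnt (u ++ v) c + (z i == c) * E)%N.
  by rewrite !cnt_cat /cnt count_nseq/= addnCA addnC.
move=> [Bw hw]; have Buv : balanced (u ++ v).
  by move=> c; have := Bw c; rewrite cE dvdn_addl ?dvdn_mull.
split=> //; move: hw.
rewrite (@eq_zprod _ (fun c => cnt (u ++ v) c %/ E + (z i == c))%N); last first.
  by move=> c; rewrite cE divnDr ?dvdn_mull// mulnK.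
rewrite zprodD zprod1 !eval_cat eval_nseq -/(z i) mulgA => hw.
apply: (mulIg (z i)); rewrite hw -!mulgA; congr (_ * _)%g.
exact/central_eval.
Qed.

(** Take a representing word of least code. A swap would lower an unsorted one; once it is sorted,
    [E] equal letters are adjacent and could be dropped. *)
Let normal_form h : commutator_products (gen_subgroup (range y)) h ->
  exists w, [/\ represents w h, sorted le_idx w & forall i, (count_mem i w < E)%N].
Proof.
move=> /commutator_represented[w0 rw0].
have ex : exists n, `[< exists w, represents w h /\ (code w).1 = n >].
  by exists (code w0).1; apply/asboolP; exists w0.
have [n /asboolP[w [rw wn]] minn] := ex_minnP ex.
have {}minn v : represents v h -> ((code w).1 <= (code v).1)%N.
  by move=> rv; rewrite wn; apply: minn; apply/asboolP; exists v.
have sw : sorted le_idx w.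
  apply/negPn/negP => /unsorted_split[u [a [b [v [wE ba]]]]].
  rewrite wE in rw minn; have := minn _ (represents_swap rw); apply/negP.
  rewrite -ltnNge code_cat//= !code_size/= expnS.
  have := ltn_ord (conj_index b a); set B := (_ ^ _)%N; set k := nat_of_ord (conj_index _ _).
  move=> kq; have Bgt0 : (0 < B)%N by rewrite expn_gt0.
  (* The conjugated letter has digit at most [q], too small to offset the smaller digit in front of
     it. *)
  have : (k.+1 + b.+1 * q.+1 < b.+1 + a.+1 * q.+1)%N by nia.
  by rewrite -(ltn_pmul2r Bgt0) !mulnDl; lia.
exists w; split=> // i; rewrite ltnNge; apply/negP => /(sorted_block sw)[u [v wE]].
rewrite wE in rw minn; have := minn _ (represents_drop rw); apply/negP.
rewrite -ltnNge -(prednK E_gt0).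
elim: E.-1 => [|k IHk]; first exact: code_drop.
by apply: ltn_trans IHk _; exact: code_drop.
Qed.

(** A sorted word is determined by its exponents, for which there are [q! ^ q] choices, and a word
    represents at most one element. *)
Lemma card_commutator_products_generated :
  exists s : seq G, commutator_products (gen_subgroup (range y)) `<=` [set x | x \in s] /\
    size s = (q`! ^ q)%N.
Proof.
pose P (f : {ffun 'I_q -> 'I_E}) h := exists w,
  [/\ represents w h, sorted le_idx w & forall i, count_mem i w = f i].
exists [seq xget 1%g (P f) | f <- enum {ffun 'I_q -> 'I_E}]; split; last first.
  by rewrite size_map -cardE card_ffun !card_ord.
move=> h /normal_form[w [rw sw cw]] /=.
pose f : {ffun 'I_q -> 'I_E} := [ffun i => Ordinal (cw i)].
have Ph : P f h by exists w; split=> // i; rewrite ffunE.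
apply/mapP; exists f; first by rewrite mem_enum.
apply/esym/xget_unique => // h' [w' [rw' sw' cw']].
have ww' : w' = w.
  apply: (sorted_eq le_idx_trans) => //.
  - by move=> a b /anti_leq/val_inj.
  - by apply/allP => i _; rewrite /= cw' ffunE.
case: rw rw' => _ wh [_]; rewrite ww' -wh; exact: mulIg.
Qed.

End CollectionProcess.

(** * Groups boundedly generated by elements with few conjugates *)

Definition centralizer_of (G : groupType) (S : set G) : set G :=
  [set g | forall s, S s -> commute g s].

Definition gprod (G : groupType) (xs : seq G) : G := foldr mulg 1%g xs.

Definition set_power (G : groupType) (X : set G) (n : nat) : set G :=
  [set g | exists xs, [/\ size xs = n, {in xs, forall x, X x} & g = gprod xs]].

Section GroupFacts.
Variable G : groupType.
Implicit Types (x y g h : G) (S H : set G) (xs : seq G).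

Lemma gprod_cat xs ys : gprod (xs ++ ys) = (gprod xs * gprod ys)%g.
Proof. by elim: xs => [|x xs IHxs] /=; rewrite ?mul1g// IHxs mulgA. Qed.

Lemma gprod_subgroup H xs : is_subgroup H -> {in xs, forall x, H x} -> H (gprod xs).
Proof.
move=> [H1 [HM _]]; elim: xs => [|x xs IHxs] //= xH.
apply: HM; first by apply: xH; rewrite mem_head.
by apply: IHxs => z zs; apply: xH; rewrite inE zs orbT.
Qed.

Lemma commute_gprod g xs : {in xs, forall x, commute g x} -> commute g (gprod xs).
Proof.
elim: xs => [|x xs IHxs] gx /=; first exact: commute1.
apply: commuteM; first by apply: gx; rewrite mem_head.
by apply: IHxs => z zs; apply: gx; rewrite inE zs orbT.
Qed.

Lemma gen_subgroup_min S H : is_subgroup H -> S `<=` H -> gen_subgroup S `<=` H.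
Proof. by move=> HH SH g; apply. Qed.

Lemma gen_subgroupS S S' : S `<=` S' -> gen_subgroup S `<=` gen_subgroup S'.
Proof.
move=> SS'; apply: gen_subgroup_min; first exact: gen_subgroup_subgroup.
by move=> x /SS'; exact: sub_gen_subgroup.
Qed.

Lemma subgroupJ H x y : is_subgroup H -> H x -> H y -> H (x ^ y)%g.
Proof. by move=> [_ [HM HV]] Hx Hy; rewrite conjgE; apply: (HM _ _ (HV _ Hy)); exact: HM. Qed.

Lemma gen_subgroupJ S t : (forall x, S x -> S (x ^ t)%g) ->
  forall g, gen_subgroup S g -> gen_subgroup S (g ^ t)%g.
Proof.
move=> SJ g; have [g1 [gM gV]] := gen_subgroup_subgroup S.
apply: (@gen_subgroup_min S [set g | gen_subgroup S (g ^ t)%g]).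
- by split; [rewrite /= conj1g|split=> [a b ? ?|a ?] /=; rewrite ?conjMg ?conjVg; auto].
- by move=> x /SJ; exact: sub_gen_subgroup.
Qed.

Lemma commutator_productsJ S t : (forall x, S x -> S (x ^ t)%g) ->
  forall g, commutator_products S g -> commutator_products S (g ^ t)%g.
Proof.
move=> SJ; apply: gen_subgroupJ => _ [a Sa [b Sb <-]].
by rewrite conjRg; exists (a ^ t)%g; [exact: SJ|exists (b ^ t)%g; [exact: SJ|]].
Qed.

Lemma commutator_products_subgroup S : is_subgroup (commutator_products S).
Proof. exact: gen_subgroup_subgroup. Qed.

Lemma mem_commutator_products S x y : S x -> S y -> commutator_products S [~ x, y]%g.
Proof. by move=> Sx Sy; apply: sub_gen_subgroup; exists x => //; exists y. Qed.

Lemma conjugates_list (X : set G) K :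
  (forall x, X x -> index_le (centralizer_of [set x]) K) ->
  forall x, X x -> exists s : seq G, (size s <= K)%N /\
    (forall g, (x ^ g)%g \in s) /\ (forall y, y \in s -> exists g, y = x ^ g)%g.
Proof.
(* Writing [g^-1 = h c] with [h] in [s] and [c] centralizing [x] gives [x ^ g = x ^ h^-1]. *)
move=> XK x /XK[s [sK sG]]; exists [seq (x ^ g^-1)%g | g <- s]; rewrite size_map.
split=> //; split=> [g|y /mapP[g _ ->]]; last by exists g^-1%g.
have [h hs /(_ x erefl) cx] := sG g^-1%g.
apply/mapP; exists h => //; rewrite -[g in LHS](mulgK h) conjgM; congr (_ ^ _)%g.
apply/conjg_fixP/commgP; rewrite -[(g * h)%g]invgK invgM.
exact/commuteV/commute_sym.
Qed.

Section BoundedClasses.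
Variables (X : set G) (K : nat).
Hypothesis XK : forall x, X x -> index_le (centralizer_of [set x]) K.
Hypothesis XJ : forall x g, X x -> X (x ^ g)%g.

Lemma conjugates_gprod_list xs : {in xs, forall x, X x} ->
  exists s : seq G, (size s <= K ^ size xs)%N /\ forall g, (gprod xs ^ g)%g \in s.
Proof.
elim: xs => [|x xs IHxs] xX /=.
  by exists [:: 1%g]; split=> // g; rewrite conj1g mem_head.
have [s [sK sJ]] : exists s : seq G, (size s <= K ^ size xs)%N /\ forall g, (gprod xs ^ g)%g \in s.
  by apply: IHxs => z zs; apply: xX; rewrite inE zs orbT.
have [t [tK [tJ _]]] := conjugates_list XK (xX x (mem_head _ _)).
exists [seq (a * b)%g | a <- t, b <- s]; split=> [|g].
  by rewrite size_allpairs expnS leq_mul.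
by rewrite conjMg; apply/allpairsP; exists ((x ^ g)%g, (gprod xs ^ g)%g); rewrite tJ sJ.
Qed.

Lemma conjugation_closure xs : {in xs, forall x, X x} ->
  exists Y : seq G, [/\ (size Y <= K * size xs)%N, {subset xs <= Y},
    {in Y, forall y, X y} & {in Y, forall y g, (y ^ g)%g \in Y}].
Proof.
elim: xs => [|x xs IHxs] xX /=; first by exists [::]; split.
have [Y [YK xsY YX YJ]] : exists Y : seq G, [/\ (size Y <= K * size xs)%N,
    {subset xs <= Y}, {in Y, forall y, X y} & {in Y, forall y g, (y ^ g)%g \in Y}].
  by apply: IHxs => z zs; apply: xX; rewrite inE zs orbT.
have Xx : X x by apply: xX; rewrite mem_head.
have [t [tK [tJ tE]]] := conjugates_list XK Xx.
exists (t ++ Y); split.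
- by rewrite size_cat mulnS leq_add.
- move=> z; rewrite inE mem_cat => /orP[/eqP ->|/xsY ->]; last by rewrite orbT.
  by rewrite -[x in x \in t]conjg1 tJ.
- by move=> z; rewrite mem_cat => /orP[/tE[g ->]|/YX //]; exact: XJ.
- move=> z; rewrite mem_cat => /orP[/tE[g ->]|zY] h; rewrite mem_cat.
    by rewrite -conjgM tJ.
  by rewrite YJ ?orbT.
Qed.

Variable Gam : set G.
Hypothesis GamG : is_subgroup Gam.
Hypothesis XGam : X `<=` Gam.

(** The centralizer of [xs] may have index exponential in [size xs], yet [K] new generators per
    element suffice: once [g] is corrected to commute with the tail, one more factor per coset of
    the centralizer of the head is enough. *)
Lemma chain_transversal xs : {in xs, forall x, X x} ->
  exists bs : seq G, [/\ (size bs <= K * size xs)%N, {in bs, forall b, Gam b} &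
    forall g, Gam g -> exists w, gen_subgroup [set` bs] w /\
      {in xs, forall x, commute (g * w^-1)%g x}].
Proof.
have [Gam1 [GamM GamV]] := GamG.
elim: xs => [|x xs IHxs] xX /=.
  exists [::]; split=> // g _; exists 1%g; split=> //.
  by have [] := gen_subgroup_subgroup (G := G) [set` [::]].
have xsX : {in xs, forall x, X x} by move=> z zs; apply: xX; rewrite inE zs orbT.
have [bs [bsK bsGam bsP]] := IHxs xsX.
have [s [sK sG]] := XK (xX x (mem_head _ _)).
pose fixes_xs d := Gam d /\ {in xs, forall z, commute d z}.
(* If the coset of [g0] provides no such element, the default 1 still lies in [Gam] and commutes
   with [xs]. *)
pose d g0 := xget 1%g [set d | fixes_xs d /\ commute (g0^-1 * d^-1)%g x].
have dGam g0 : Gam (d g0) by rewrite /d; case: xgetP => // e _ [[]].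
have dxs g0 : {in xs, forall z, commute (d g0) z}.
  rewrite /d; case: xgetP => [e _ [[]]//|_ z _]; exact/commute_sym/commute1.
exists ([seq d g0 | g0 <- s] ++ bs); split.
- by rewrite size_cat size_map mulnS leq_add.
- by move=> b; rewrite mem_cat => /orP[/mapP[g0 _ ->]|bb]; [exact: dGam|exact: bsGam].
move=> g Gg; have [w [bw gw]] := bsP _ Gg.
have Gw : Gam w by exact: (gen_subgroup_min GamG bsGam bw).
pose c := (g * w^-1)%g.
have Gc : Gam c by apply: GamM => //; exact: GamV.
have [g0 g0s /(_ x erefl) g0c] := sG c^-1%g.
have [_ dx] : [set d | fixes_xs d /\ commute (g0^-1 * d^-1)%g x] (d g0).
  by rewrite /d; apply: xgetPex; exists c.
exists (d g0 * w)%g; split.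
  have [_ [gM _]] := gen_subgroup_subgroup [set` [seq d g0 | g0 <- s] ++ bs].
  apply: gM.
    by apply: sub_gen_subgroup; rewrite /= mem_cat map_f.
  apply: gen_subgroupS bw => b /= bbs; by rewrite mem_cat bbs orbT.
have -> : (g * (d g0 * w)^-1 = c * (d g0)^-1)%g by rewrite invgM mulgA.
move=> z; rewrite inE => /orP[/eqP ->|zs]; last first.
  apply/commute_sym/commuteM; first exact/commute_sym/gw.
  exact/commuteV/commute_sym/dxs.
have -> : (c * (d g0)^-1 = (g0^-1 * c^-1)^-1 * (g0^-1 * (d g0)^-1))%g.
  by rewrite invgM !invgK mulgA mulgK.
by apply/commute_sym/commuteM; [apply/commuteV|]; apply/commute_sym.
Qed.

Variable r : nat.
Hypothesis GamE : Gam `<=` set_power X r.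

Lemma factor_list bs : {in bs, forall b, Gam b} ->
  exists ys : seq G, [/\ size ys = (r * size bs)%N, {in ys, forall x, X x} &
    {in bs, forall b, gen_subgroup [set` ys] b}].
Proof.
elim: bs => [|b bs IHbs] bG; first by exists [::]; split; rewrite ?muln0.
have [|ys [sys ysX bys]] := IHbs.
  by move=> z zs; apply: bG; rewrite inE zs orbT.
have [xs [sxs xsX bE]] := GamE (bG b (mem_head _ _)).
exists (xs ++ ys); split.
- by rewrite size_cat sxs sys mulnS.
- by move=> z; rewrite mem_cat => /orP[zs|zs]; [exact: xsX|exact: ysX].
- move=> z; rewrite inE => /orP[/eqP ->|/bys]; last first.
    by apply: gen_subgroupS => x /= xys; rewrite mem_cat xys orbT.
  rewrite bE; apply: gprod_subgroup; first exact: gen_subgroup_subgroup.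
  by move=> x xxs; apply: sub_gen_subgroup; rewrite /= mem_cat xxs.
Qed.

(** A maximum exists because an element of [Gam] is a product of [r] elements of [X], hence has at
    most [K ^ r] conjugates. *)
Lemma maximal_class : exists a (s : seq G), [/\ Gam a, uniq s,
  {in s, forall y, exists2 g, Gam g & y = (a ^ g)%g} &
  forall a' (s' : seq G), Gam a' -> uniq s' ->
    {in s', forall y, exists2 g, Gam g & y = (a' ^ g)%g} -> (size s' <= size s)%N].
Proof.
pose P n := `[< exists a (s : seq G), [/\ Gam a, uniq s,
  {in s, forall y, exists2 g, Gam g & y = (a ^ g)%g} & size s = n] >].
have exP : exists n, P n.
  exists 0%N; apply/asboolP; exists 1%g, [::]; split=> //; by case: GamG.
have leP n : P n -> (n <= K ^ r)%N.
  move=> /asboolP[a [s [Ga us sa <-]]].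
  have [xs [<- xsX aE]] := GamE Ga.
  have [t [tK tJ]] := conjugates_gprod_list xsX.
  apply: leq_trans tK; apply: uniq_leq_size => // y /sa[g _ ->].
  by rewrite aE.
have [n /asboolP[a [s [Ga us sa sn]]] maxn] := ex_maxnP exP leP.
exists a, s; split=> // a' s' Ga' us' sa'; rewrite sn; apply: maxn.
by apply/asboolP; exists a', s'.
Qed.

(** The bound on [q] counts letters: [r] factors of [a] and [r] for each of [K * r] transversal
    elements make up [Y1]; a transversal for [Y1] multiplies this by [1 + K * r], and closing under
    conjugation by [K]. *)
Theorem commutator_products_card : exists (q : nat) (s : seq G),
  [/\ (q <= K * ((r + K * r * r) * (1 + K * r)))%N,
      commutator_products Gam `<=` [set` s] & size s = (q`! ^ q)%N].
Proof.
have [Gam1 [GamM GamV]] := GamG.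
have [a [s [Ga us sa smax]]] := maximal_class.
have [xs [sxs xsX aE]] := GamE Ga.
have [bs1 [bs1K bs1Gam bs1P]] := chain_transversal xsX.
have [ys1 [sys1 ys1X bs1ys]] := factor_list bs1Gam.
(* What commutes with [Y1] commutes with [a] and with the subgroup generated by [bs1], which already
   yields every conjugate of [a] under [Gam]. *)
pose Y1 := xs ++ ys1.
have Y1X : {in Y1, forall x, X x}.
  by move=> z; rewrite mem_cat => /orP[zs|zs]; [exact: xsX|exact: ys1X].
have [bs2 [bs2K bs2Gam bs2P]] := chain_transversal Y1X.
have [ys2 [sys2 ys2X bs2ys]] := factor_list bs2Gam.
have Y2X : {in Y1 ++ ys2, forall x, X x}.
  by move=> z; rewrite mem_cat => /orP[zs|zs]; [exact: Y1X|exact: ys2X].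
have [Y0 [sY0 Y2Y0 Y0X Y0J]] := conjugation_closure Y2X.
pose Y := undup Y0; pose T0 := gen_subgroup [set` Y].
have YJ y g : y \in Y -> (y ^ g)%g \in Y by rewrite !mem_undup => /Y0J.
have Y2Y : {subset Y1 ++ ys2 <= Y} by move=> z /Y2Y0; rewrite mem_undup.
have T0G : is_subgroup T0 by exact: gen_subgroup_subgroup.
have [T01 [T0M T0V]] := T0G.
pose D := commutator_products T0.
have DG : is_subgroup D by exact: commutator_products_subgroup.
have [D1 [DM DV]] := DG.
have DJ t g : T0 t -> D g -> D (g ^ t)%g.
  move=> Tt; apply: (@commutator_productsJ T0 t) => x Tx; exact: (subgroupJ T0G Tx Tt).
have sub_T0 (ws : seq G) : {subset ws <= Y} -> gen_subgroup [set` ws] `<=` T0.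
  by move=> wsY; apply: gen_subgroupS => z /= /wsY.
have Ta : T0 a.
  rewrite aE; apply: gprod_subgroup => // x xxs; apply: sub_gen_subgroup => /=.
  by apply: Y2Y; rewrite !mem_cat xxs.
have Tbs1 : gen_subgroup [set` bs1] `<=` T0.
  apply: gen_subgroup_min => // b /bs1ys; apply: sub_T0 => z zys.
  by apply: Y2Y; rewrite !mem_cat zys orbT.
have Tbs2 : gen_subgroup [set` bs2] `<=` T0.
  apply: gen_subgroup_min => // b /bs2ys; apply: sub_T0 => z zys.
  by apply: Y2Y; rewrite !mem_cat zys orbT.
pose U := [set u | Gam u /\ {in Y1, forall y, commute u y}].
have split_Gam g : Gam g -> exists u t, [/\ U u, T0 t & g = (u * t)%g].
  move=> Gg; have [w [bw gw]] := bs2P _ Gg.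
  exists (g * w^-1)%g, w; split; [|exact: Tbs2|by rewrite mulgVK].
  split=> //; apply: GamM => //; exact/GamV/(gen_subgroup_min GamG bs2Gam bw).
have U_gen u w : U u -> gen_subgroup [set` Y1] w -> commute u w.
  move=> [_ uY] Yw; apply/commute_sym.
  apply: (gen_subgroup_min (centralizer_of_subgroup [set u]) _ Yw) => // y /uY uy _ ->.
  exact/commute_sym.
have gen1 (ws : seq G) : {subset ws <= Y1} -> gen_subgroup [set` ws] `<=` gen_subgroup [set` Y1].
  by move=> wsY; apply: gen_subgroupS => z /= /wsY.
have Ua u : U u -> commute u a.
  move=> Uu; apply: U_gen => //; rewrite aE; apply: gprod_subgroup.
    exact: gen_subgroup_subgroup.
  by move=> x xxs; apply: sub_gen_subgroup; rewrite /= mem_cat xxs.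
have bs1Y : gen_subgroup [set` bs1] `<=` gen_subgroup [set` Y1].
  apply: gen_subgroup_min; first exact: gen_subgroup_subgroup.
  by move=> b /bs1ys; apply: gen1 => z zys; rewrite mem_cat zys orbT.
have Ubs1 u w : U u -> gen_subgroup [set` bs1] w -> commute u w.
  by move=> Uu /bs1Y; exact: U_gen.
have class_a g : Gam g -> exists w, gen_subgroup [set` bs1] w /\ (a ^ g = a ^ w)%g.
  move=> /bs1P[w [bw gw]]; exists w; split=> //.
  rewrite -{1}[g](mulgVK w) conjgM; congr (_ ^ _)%g; apply/conjg_fixP/commgP.
  by rewrite aE; exact/commute_sym/commute_gprod.
(* Maximality of the class of [a] forces the class of [u * a] to be [u] times
   the class of [a]. *)
have commUG u g : U u -> Gam g -> D [~ u, g]%g.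
  move=> Uu Gg; have [Gu _] := Uu.
  have sJ y : y \in s -> exists w, gen_subgroup [set` bs1] w /\ y = (a ^ w)%g.
    by move=> /sa[h /class_a[w [bw ->]] ->]; exists w.
  have [y ys uag] : exists2 y, y \in s & ((u * a) ^ g = u * y)%g.
    (* Each [u * y] is a conjugate of [u * a], because [y = a ^ w] with [w] commuting with [u]; one
       further conjugate would exceed the maximum. *)
    apply/mapP; apply/negPn/negP => nus.
    have := smax (u * a)%g (((u * a) ^ g)%g :: [seq (u * y)%g | y <- s]).
    rewrite /= size_map ltnn => H; apply: notF; apply: H.
    - exact: GamM.
    - by rewrite nus map_inj_uniq//; exact: mulgI.
    - move=> z; rewrite inE => /orP[/eqP ->|/mapP[y /sJ[w [bw ->]] ->]]; first by exists g.
      exists w; first exact: (gen_subgroup_min GamG bs1Gam bw).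
      by rewrite conjMg; congr (_ * _)%g; apply/esym/conjg_fixP/commgP/Ubs1.
  have [w [/Tbs1 Tw yE]] := sJ _ ys.
  have [u' [t [Uu' Tt gE]]] := split_Gam _ Gg.
  have agE : (a ^ g = a ^ t)%g.
    rewrite gE conjgM; congr (_ ^ _)%g; apply/conjg_fixP/commgP/commute_sym.
    exact: Ua.
  (* Cancelling [u] in [(u * a) ^ g = u * y] leaves [[~ u, g] = y * (a ^ g)^-1], where [y = a ^ w]
     and [a ^ g = a ^ t] with [w] and [t] in [T0]. *)
  have -> : [~ u, g]%g = ([~ w, a^-1] * [~ a^-1, t])%g.
    have -> : [~ u, g]%g = (y * (a ^ g)^-1)%g.
      by apply: (mulgI u); rewrite [RHS]mulgA -uag conjMg mulgK commgEl mulKVg.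
    by rewrite agE yE !commgEl !conjgE !invgM !invgK !mulgA mulgVK.
  by apply: DM; apply: mem_commutator_products => //; exact: T0V.
have commTG t g : T0 t -> Gam g -> D [~ t, g]%g.
  move=> Tt Gg; have [u [t' [Uu Tt' ->]]] := split_Gam _ Gg.
  have Gt : Gam t.
    apply: (gen_subgroup_min GamG _ Tt) => y; rewrite /= mem_undup => yY.
    exact/XGam/Y0X.
  rewrite -invgR; apply: DV; rewrite commgMl; apply: DM.
    by apply: DJ => //; exact: commUG.
  exact: mem_commutator_products.
have GamD : commutator_products Gam `<=` D.
  apply: gen_subgroup_min => // _ [g Gg [h Gh <-]].
  have [u [t [Uu Tt ->]]] := split_Gam _ Gg.
  rewrite commgMl; apply: DM; first by apply: DJ => //; exact: commUG.
  exact: commTG.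
pose f (i : 'I_(size Y)) := nth 1%g Y i.
have fE : range f = [set` Y].
  apply/seteqP; split=> [_ [i _ <-]|y /= yY]; first exact: mem_nth.
  have iY : (index y Y < size Y)%N by rewrite index_mem.
  by exists (Ordinal iY) => //; rewrite /f/= nth_index.
have [||v [vD sv]] := @card_commutator_products_generated G (size Y) f.
- by move=> i j /eqP; rewrite nth_uniq ?undup_uniq// => /eqP/val_inj.
- move=> i j; have : (f i ^ f j)%g \in Y by apply: YJ; exact: mem_nth.
  have : [set` Y] = range f by []. 
  move=> YE fY; have : [set` Y] (f i ^ f j)%g by []. 
  by rewrite -fE => -[k _ <-]; exists k.
exists (size Y), v; split=> //; last by move=> x /GamD; rewrite /D /T0 -fE; exact: vD.
apply: leq_trans (size_undup _) _; apply: leq_trans sY0 _; rewrite leq_mul2l.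
apply/orP; right; rewrite size_cat sys2.
have Y1K : (size Y1 <= r + K * r * r)%N.
  by rewrite size_cat sxs sys1 leq_add2l mulnC leq_mul2r -sxs bs1K orbT.
rewrite mulnDr muln1 leq_add// (leq_trans (leq_mul (leqnn r) bs2K))//.
by rewrite mulnA (mulnC r) mulnC leq_mul2r Y1K orbT.
Qed.

End BoundedClasses.
End GroupFacts.

(** * Masses of sets, disjoint translates and commuting probability *)

Lemma esumZl_le (R : realType) (T : choiceType) (S : set T) (c : R) (a : T -> \bar R) :
  0 <= c -> (forall i, 0 <= a i)%E ->
  (\esum_(i in S) (c%:E * a i) <= c%:E * \esum_(i in S) a i)%E.
Proof.
move=> c0 a0; apply: ge_ereal_sup => _ [X [finX XS] <-].
rewrite -ge0_mule_fsumr// lee_wpmul2l// ?lee_fin//.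
by apply: ereal_sup_ubound; exists X.
Qed.

Section Mass.
Variables (R : realType) (G : groupType) (nu : G -> R).
Hypothesis nuP : is_prob nu.

Definition mass (A : set G) : R := fine (\esum_(g in A) (nu g)%:E)%E.

Let nu_ge0 g : (0 <= (nu g)%:E)%E. Proof. by rewrite lee_fin; have [] := nuP. Qed.

Let massE A : (\esum_(g in A) (nu g)%:E = (mass A)%:E)%E.
Proof.
rewrite /mass fineK// ge0_fin_numE; last exact: esum_ge0.
have [_ nu1] := nuP; have := esumID A [set: G] (fun g => (nu g)%:E) (fun g _ => nu_ge0 g).
rewrite nu1 setTI => E1; apply: (@le_lt_trans _ _ 1%E); last exact: ltry.
by rewrite E1 leeDl// esum_ge0.
Qed.

Lemma mass_ge0 A : 0 <= mass A.
Proof. by rewrite -lee_fin -massE esum_ge0. Qed.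

Lemma massT : mass setT = 1.
Proof. by apply/eqP; rewrite -eqe -massE; have [_ ->] := nuP. Qed.

Lemma massU A B : A `&` B = set0 -> mass (A `|` B) = mass A + mass B.
Proof.
move=> AB0; apply/eqP; rewrite -eqe EFinD -!massE; apply/eqP.
rewrite (esumID A (A `|` B))//; congr (_ + _)%E; congr esum.
  by apply/seteqP; split=> [x []//|x Ax]; split=> //; left.
apply/seteqP; split=> [x [[]]//|x Bx]; split; first by right.
by move=> Ax; have : set0 x by rewrite -AB0.
Qed.

Lemma mass_le1 A : mass A <= 1.
Proof. by rewrite -massT -(setUv A) massU ?setICr// lerDl mass_ge0. Qed.

(** The set on the right is the translate [bA]; its mass sums [nu (b * g)] over [A], which differs
    from the mass of [A] by at most the l1 distance. *)
Lemma mass_lcoset b (A : set G) eps :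
  (l1dist (translate b^-1 nu) nu <= eps%:E)%E ->
  mass A <= mass [set g | A (b^-1 * g)%g] + eps.
Proof.
move=> dist; rewrite -lee_fin EFinD -massE.
have -> : ((mass [set g | A (b^-1 * g)%g])%:E = \esum_(g in A) (nu (b * g)%g)%:E)%E.
  rewrite -massE; apply: reindex_esum; split=> [g Ag|x y _ _|g Ag] /=.
  - by rewrite mulKg.
  - exact: mulgI.
  - by exists (b^-1 * g)%g => //; rewrite mulKVg.
apply: (@le_trans _ _ (\esum_(g in A) ((nu (b * g)%g)%:E +
    `|translate b^-1 nu g - nu g|%:E))%E).
  apply: le_esum => g _; rewrite -EFinD lee_fin /translate invgK.
  by rewrite -lerBlDl distrC ler_norm.
rewrite esumD//.
apply: leeD => //; apply: le_trans dist; rewrite /l1dist.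
rewrite [leRHS](esumID A)// ?setTI ?leeDl ?esum_ge0//.
Qed.

(** [A] is an arbitrary set, so this concerns translates [bA] and [b'A]; it is boolean for use with
    [pairwise]. *)
Definition lcosets_disjoint (A : set G) (b b' : G) : bool :=
  `[< forall x y, A x -> A y -> (b * x <> b' * y)%g >].

(** Each translate has mass at least [mass A - eps], and their union has mass at most 1. *)
Lemma mass_disjoint_lcosets (A : set G) (s : seq G) eps :
  {in s, forall b, (l1dist (translate b^-1 nu) nu <= eps%:E)%E} ->
  pairwise (lcosets_disjoint A) s ->
  (size s)%:R * mass A <= 1 + (size s)%:R * eps.
Proof.
move=> dist ps; apply: le_trans
  (_ : mass [set g | exists2 b, b \in s & A (b^-1 * g)%g] + (size s)%:R * eps <= _);
  last by rewrite lerD2r mass_le1.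
elim: s dist ps => [|b s IHs] dist /=; first by rewrite !mul0r addr0 mass_ge0.
move=> /andP[/allP bs /IHs{}IHs].
have -> : [set g | exists2 b0, b0 \in b :: s & A (b0^-1 * g)%g] =
    [set g | A (b^-1 * g)%g] `|` [set g | exists2 b0, b0 \in s & A (b0^-1 * g)%g].
  apply/seteqP; split=> [g [c]|g [Ag|[c cs Ac]]] /=.
  - by rewrite inE => /orP[/eqP -> ?|? ?]; [left|right; exists c].
  - by exists b => //; rewrite mem_head.
  - by exists c => //; rewrite inE cs orbT.
rewrite massU; last first.
  apply/seteqP; split=> // g [Ag [c cs Ac]].
  by have /asboolP/(_ _ _ Ag Ac) := bs c cs; rewrite !mulKVg.
rewrite -natr1 !mulrDl !mul1r.
have := mass_lcoset A (dist b (mem_head _ _)).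
have : {in s, forall b, (l1dist (translate b^-1 nu) nu <= eps%:E)%E}.
  by move=> c cs; apply: dist; rewrite inE cs orbT.
by move=> /IHs; lra.
Qed.

(** [dc nu] is the [nu]-average of the mass of the centralizer of [x], which is at most 1 on [X] and
    at most [c] elsewhere. *)
Lemma dc_le (X : set G) (c : R) : 0 <= c <= 1 ->
  (forall x, ~ X x -> mass (centralizer_of [set x]) <= c) ->
  (dc nu <= (c + (1 - c) * mass X)%:E)%E.
Proof.
move=> /andP[c0 c1] Xc; have [nu0 _] := nuP.
have -> : dc nu = (\esum_(x in [set: G]) \esum_(y in centralizer_of [set x])
    (nu x * nu y)%:E)%E.
  rewrite esum_esum => [|x y _ _]; last by rewrite lee_fin mulr_ge0.
  rewrite /dc; congr esum; apply/seteqP; split=> [[x y] /= xy|[x y] /= [_]].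
    by split=> // _ ->; exact/commute_sym.
  by move=> /(_ x erefl)/commute_sym.
apply: (@le_trans _ _ (\esum_(x in [set: G])
    (c%:E * (nu x)%:E + (1 - c)%:E * (if x \in X then (nu x)%:E else 0)))%E).
  apply: le_esum => x _.
  apply: (@le_trans _ _ ((nu x)%:E * (mass (centralizer_of [set x]))%:E)%E).
    rewrite -massE; apply: le_trans; last exact: esumZl_le.
    by apply: le_esum => y _; rewrite EFinM.
  case: ifPn => [xX|/negP xX].
    rewrite -!EFinM -EFinD lee_fin -mulrDl addrC subrK mul1r.
    by rewrite ler_piMr// mass_le1.
  rewrite mule0 adde0 -!EFinM lee_fin mulrC ler_wpM2r//.
  by apply: Xc => Xx; apply: xX; rewrite inE.
rewrite esumD; first 1 last.
- by move=> x _; rewrite -EFinM lee_fin mulr_ge0.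
- move=> x _; apply: mule_ge0; first by rewrite lee_fin subr_ge0.
  by case: ifP.
rewrite [leRHS]EFinD; apply: leeD.
  apply: le_trans (esumZl_le _ c0 nu_ge0) _.
  by rewrite massE massT -EFinM mulr1.
rewrite [leRHS]EFinM -massE (esum_mkcond X); apply: esumZl_le; first by rewrite subr_ge0.
by move=> x; case: ifP.
Qed.

End Mass.

(** The limsup is an infimum of suprema over neighbourhoods of infinity. The indices with finitely
    many small translation distances form such a neighbourhood [V], so the supremum over [V] exceeds
    [beta - eps]. *)
Lemma dcM_almost_attained (R : realType) (G : groupType) (mu : nat -> G -> R)
    (beta eps : R) (B : seq G) :
  almost_invariant mu -> (beta%:E <= dcM mu)%E -> 0 < eps ->
  exists2 n, ((beta - eps)%:E <= dc (mu n))%E &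
    {in B, forall b, (l1dist (translate b (mu n)) (mu n) <= eps%:E)%E}.
Proof.
move=> [muP mu_inv] betaM eps0.
pose V := [set n | {in B, forall b, (l1dist (translate b (mu n)) (mu n) <= eps%:E)%E}].
have nV : \oo V.
  have near1 b : \forall n \near \oo, (l1dist (translate b (mu n)) (mu n) <= eps%:E)%E.
    have nb : nbhs (0%:E : \bar R) [set x : \bar R | (x < eps%:E)%E].
      apply: open_nbhs_nbhs; split; first exact: open_ereal_lt_ereal.
      by rewrite /= lte_fin.
    by have [N _ distN] := mu_inv b _ nb; exists N => // n /distN/ltW.
  rewrite /V; elim: B {V} => [|b B IHB]; first by exists 0%N.
  have [N _ distN] := near1 b; have [N' _ distN'] := IHB.
  exists (maxn N N') => // n; rewrite /= geq_max => /andP[Nn N'n] c.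
  by rewrite inE => /orP[/eqP ->|]; [exact: distN|exact: distN'].
have : ((beta - eps)%:E < ereal_sup [set dc (mu n) | n in V])%E.
  apply: (@lt_le_trans _ _ (dcM mu)).
    by apply: lt_le_trans betaM; rewrite lte_fin; lra.
  by apply: ereal_inf_lbound; exists V.
by move=> /ereal_sup_gt[_ [n Vn <-] /ltW dcn]; exists n.
Qed.

(** * Cosets met by balls, and powers of a set *)

Definition cosets_distinct (G : groupType) (H : set G) (g h : G) : bool :=
  `[< ~ H (g^-1 * h)%g >].

Section Cosets.
Variables (G : groupType).
Implicit Types (H A : set G) (S s : seq G) (g h x y t : G).

Lemma cosets_lcosets_disjoint A H s : (forall x y, A x -> A y -> H (x * y^-1)%g) ->
  pairwise (cosets_distinct H) s -> pairwise (lcosets_disjoint A) s.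
Proof.
move=> AH; apply: sub_pairwise => g h /asboolP gh; apply/asboolP => x y Ax Ay gx.
apply: gh; have -> : (g^-1 * h = x * y^-1)%g; last exact: AH.
by rewrite -(mulKg g x) gx -!mulgA mulgV mulg1.
Qed.

Fixpoint ball S n : seq G :=
  if n isn't n'.+1 then [:: 1%g]
  else ball S n' ++ [seq (t * x)%g | t <- S, x <- ball S n'].

(* If the cosets met by the ball of radius [n] do not exhaust the group then
   some generator moves one of them to a new one, so each step gains a coset. *)
Lemma ball_cosets S H k : is_subgroup H -> {in S, forall t, t^-1%g \in S} ->
  (forall x K, is_subgroup K -> [set` S] `<=` K -> K x) ->
  ~ index_le H k -> exists s, [/\ size s = k.+1,
    {subset s <= ball S k} & pairwise (cosets_distinct H) s].
Proof.
move=> HG SV Sgen Hk; have [H1 [HM HV]] := HG.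
suff: forall j, (j <= k)%N -> exists s, [/\ size s = j.+1, 1%g \in s,
    {subset s <= ball S j} & pairwise (cosets_distinct H) s].
  by move=> /(_ k (leqnn _))[s [? _ ? ?]]; exists s.
elim=> [|j IHj] jk.
  by exists [:: 1%g]; split; rewrite ?mem_head.
have [s [sj s1 sball sH]] := IHj (ltnW jk).
pose U := [set x | exists2 g, g \in s & H (g^-1 * x)%g].
have [t [g [tS gs nUtg]]] : exists t g, [/\ t \in S, g \in s & ~ U (t * g)%g].
  apply: contrapT => no_new.
  have US t x : t \in S -> U x -> U (t * x)%g.
    move=> tS [g gs gx].
    have [c cs cg] : U (t * g)%g by apply: contrapT => nU; apply: no_new; exists t, g.
    exists c => //; have := HM _ _ cg gx.
    by rewrite -!mulgA mulKVg.
  apply: Hk; exists s; split; first by rewrite sj.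
  move=> x; suff : U (x * 1)%g by rewrite mulg1.
  (* [K] is the stabiliser of [U] under left multiplication; symmetry of [S] supplies the converse
     implication. *)
  pose K := [set g | forall y, U (g * y)%g <-> U y].
  have /(_ 1%g) -> : K x; last by exists 1%g; rewrite // mulg1 invg1.
  apply: Sgen => [|t /= tS y]; last first.
    by split=> [/(US _ _ (SV _ tS))|]; [rewrite mulKg|exact: US].
  split=> [y|]; first by rewrite mul1g.
  split=> [a b Ka Kb y|a Ka y]; first by rewrite -mulgA Ka Kb.
  by rewrite -(Ka (a^-1 * y)%g) mulKVg.
exists ((t * g)%g :: s); split; rewrite /= ?sj ?inE ?s1 ?orbT//.
- move=> x; rewrite inE => /orP[/eqP ->|/sball xj]; rewrite mem_cat; last by rewrite xj.
  by apply/orP; right; apply/allpairsP; exists (t, g); split=> //; exact: sball.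
- apply/andP; split=> //; apply/allP => h hs; apply/asboolP => tgh.
  by apply: nUtg; exists h => //; have := HV _ tgh; rewrite invgM invgK.
Qed.

Lemma not_index_le_cosets H k : is_subgroup H -> ~ index_le H k ->
  exists2 s, size s = k.+1 & pairwise (cosets_distinct H) s.
Proof.
move=> HG Hk; have [H1 [HM HV]] := HG.
suff: forall j, (j <= k.+1)%N ->
    exists2 s, size s = j & pairwise (cosets_distinct H) s by exact.
elim=> [|j IHj] jk; first by exists [::].
have [s sj sH] := IHj (ltnW jk).
have [x xs] : exists x, forall g, g \in s -> ~ H (g^-1 * x)%g.
  apply: contrapT => no_new; apply: Hk; exists s; split; first by rewrite sj -ltnS.
  move=> x; apply: contrapT => nx; apply: no_new; exists x => g gs gx.
  by apply: nx; exists g.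
exists (x :: s); rewrite /= ?sj//; apply/andP; split=> //.
apply/allP => g gs; apply/asboolP => xg; apply: (xs g gs).
by have := HV _ xg; rewrite invgM invgK.
Qed.

End Cosets.

Section SetPower.
Variables (G : groupType) (X : set G).
Implicit Types (g h x : G).

Lemma set_power0 : set_power X 0 1%g.
Proof. by exists [::]; split. Qed.

Lemma set_power1 x : X x -> set_power X 1 x.
Proof.
move=> Xx; exists [:: x]; split=> //; last by rewrite /= mulg1.
by move=> y; rewrite inE => /eqP ->.
Qed.

Lemma set_powerM m n g h : set_power X m g -> set_power X n h ->
  set_power X (m + n) (g * h)%g.
Proof.
move=> [xs [<- xsX ->]] [ys [<- ysX ->]]; exists (xs ++ ys); split.
- by rewrite size_cat.
- by move=> z; rewrite mem_cat => /orP[/xsX|/ysX].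
- by rewrite gprod_cat.
Qed.

Lemma set_powerSr n g : set_power X n.+1 g ->
  exists h x, [/\ set_power X n h, X x & g = (h * x)%g].
Proof.
move=> [xs [sxs xsX ->]]; case/lastP: xs => [|xs x] in sxs xsX *.
  by [].
move: sxs; rewrite size_rcons => -[<-].
exists (gprod xs), x; split.
- by exists xs; split=> // z zs; apply: xsX; rewrite mem_rcons inE zs orbT.
- by apply: xsX; rewrite mem_rcons mem_head.
- by rewrite -cats1 gprod_cat /= mulg1.
Qed.

Hypothesis X1 : X 1%g.

Lemma set_power_le m n : (m <= n)%N -> set_power X m `<=` set_power X n.
Proof.
move=> /subnKC <- g; elim: (n - m)%N => [|k IHk] mg; first by rewrite addn0.
rewrite addnS -addn1 -[g]mulg1; apply: set_powerM; first exact: IHk.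
exact: set_power1.
Qed.

Hypothesis XV : forall x, X x -> X x^-1%g.

Lemma set_powerV n g : set_power X n g -> set_power X n g^-1%g.
Proof.
elim: n g => [|n IHn] g.
  by move=> [[|x xs] [//= _ _ ->]]; rewrite invg1; exact: set_power0.
move=> /set_powerSr[h [x [/IHn nh Xx ->]]]; rewrite invgM -add1n.
by apply: set_powerM => //; exact/set_power1/XV.
Qed.

Lemma set_powerJ n g h : (forall x, X x -> X (x ^ h)%g) ->
  set_power X n g -> set_power X n (g ^ h)%g.
Proof.
move=> XJ; elim: n g => [|n IHn] g.
  by move=> [[|x xs] [//= _ _ ->]]; rewrite conj1g; exact: set_power0.
move=> /set_powerSr[a [x [/IHn na Xx ->]]]; rewrite conjMg -addn1.
by apply: set_powerM => //; exact/set_power1/XJ.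
Qed.

(* Elements of [X^(3i)] outside [X^(3i-1)] translate [X] to disjoint sets. *)
Lemma set_power_stable N :
  (forall s, pairwise (lcosets_disjoint X) s -> (size s <= N)%N) ->
  forall m, set_power X m `<=` set_power X (3 * N).
Proof.
move=> sN.
(* Otherwise every [i] from 1 to [N] gives a new element [c i], and with [c 0 = 1] there are [N.+1]
   disjoint translates. *)
have [i iN stab] : exists2 i, (0 < i <= N)%N &
    set_power X (3 * i) `<=` set_power X (3 * i).-1.
  apply: contrapT => no_stab.
  have new i : exists g, (0 < i <= N)%N ->
      set_power X (3 * i) g /\ ~ set_power X (3 * i).-1 g.
    have [iN|_] := boolP (0 < i <= N)%N; last by exists 1%g.
    apply: contrapT => no_g; apply: no_stab; exists i => // g ig.
    by apply: contrapT => nig; apply: no_g; exists g.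
  pose c i := if i is 0 then 1%g else xget 1%g
    [set g | (0 < i <= N)%N -> set_power X (3 * i) g /\ ~ set_power X (3 * i).-1 g].
  have cP i : (0 < i <= N)%N -> set_power X (3 * i) (c i) /\ ~ set_power X (3 * i).-1 (c i).
    case: i => [//|i]; rewrite /c; exact: (xgetPex 1%g (new i.+1)).
  have c3 i : (i <= N)%N -> set_power X (3 * i) (c i).
    by case: i => [_|i iN]; [exact: set_power0|have [] := cP i.+1 iN].
  have := sN [seq c i | i <- iota 0 N.+1].
  rewrite size_map size_iota ltnn pairwise_map => H; apply: notF; apply: H.
  have ltnP : {in [pred i | i < N.+1]%N &, subrel ltn (relpre c (lcosets_disjoint X))}.
    move=> i j; rewrite !inE !ltnS => iN jN ij; apply/asboolP => x y Xx Xy ixjy.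
    have [_] := cP j (introT andP (conj (leq_ltn_trans (leq0n i) ij) jN)); apply.
    (* A common point would put [c j] in the power [3 * i + 2], and this exponent is at most
       [(3 * j).-1] since [i < j]. *)
    have -> : c j = (c i * x * y^-1)%g by rewrite ixjy mulgK.
    apply: (@set_power_le (3 * i + 1 + 1)); first by lia.
    apply: set_powerM; last exact/set_power1/XV.
    by apply: set_powerM; [exact: c3|exact: set_power1].
  apply: (sub_in_pairwise ltnP).
    by apply/allP => i; rewrite mem_iota.
  by rewrite -(sorted_pairwise ltn_trans) iota_ltn_sorted.
have i0 : (0 < i)%N by case/andP: iN.
(* Multiplying the power [(3 * i).-1] by [X] lands in the power [3 * i], which falls back, so no
   power ever leaves it. *)
move=> m; apply: (@subset_trans _ (set_power X (3 * i).-1)); last first.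
  by apply: set_power_le; lia.
elim: m => [|m IHm]; first exact: set_power_le.
move=> _ /set_powerSr[h [x [/IHm ih Xx ->]]]; apply: stab.
have -> : (3 * i = (3 * i).-1 + 1)%N by lia.
by apply: set_powerM => //; exact: set_power1.
Qed.

End SetPower.

(** * Commuting probability and the centre *)

Lemma centre_subgroup (G : groupType) : is_subgroup (@centre G).
Proof.
have [C1 [CM CV]] := centralizer_of_subgroup [set: G].
split; first by move=> x; exact: C1.
split=> [x y Cx Cy z|x Cx z].
  by apply: (CM x y) => // s _; [exact: Cx|exact: Cy].
by apply: (CV x) => // s _; exact: Cx.
Qed.

Section CommutingProbability.
Variables (R : realType) (G : groupType) (mu : nat -> G -> R).
Hypothesis mu_inv : almost_invariant mu.

Let nuP n : is_prob (mu n). Proof. by have [] := mu_inv. Qed.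

(* If [x] does not commute with [f], then [C(x)] and [f C(x)] are disjoint, so
   off the centralizer of a fixed finite set [F] the mass of [C(x)] is at most
   about 1/2; if [F] separates the given cosets of the centre, the centralizer
   of [F] has mass at most about [1 / size s]. *)
Lemma dcM_le_centre_cosets (beta : R) (s : seq G) : (0 < size s)%N ->
  pairwise (cosets_distinct (@centre G)) s -> (beta%:E <= dcM mu)%E ->
  beta <= 1 / 2 + (2 * (size s)%:R)^-1.
Proof.
move=> s0 ps betaM; apply/ler_addgt0Pr => e e0.
(* The errors below add up to at most [5 / 2 * eps], which is under [e]; the cap [1 / 4] keeps
   [1 / 2 + eps] below 1 for [dc_le]. *)
pose eps := Num.min (e / 4) (1 / 4).
have eps0 : 0 < eps by rewrite lt_min !divr_gt0.
have eps_e : eps <= e / 4 by rewrite ge_min lexx.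
have eps_4 : eps <= 1 / 4 by rewrite ge_min lexx orbT.
(* [w g h] witnesses that [g] and [h] lie in distinct cosets of the centre; the default is
   harmless. *)
pose w (g h : G) := xget 1%g [set f | ~ commute (g^-1 * h)%g f].
pose F := [seq w g h | g <- s, h <- s].
have [n dcn dist] := dcM_almost_attained
  [seq b^-1%g | b <- 1%g :: F ++ s] mu_inv betaM eps0.
have {}dist : {in 1%g :: F ++ s, forall b,
    (l1dist (translate b^-1 (mu n)) (mu n) <= eps%:E)%E}.
  by move=> b bB; apply: dist; exact: map_f.
pose A := centralizer_of [set` F].
have Am : (size s)%:R * mass (mu n) A <= 1 + (size s)%:R * eps.
  apply: mass_disjoint_lcosets => //.
    by move=> b bs; apply: dist; rewrite inE mem_cat bs !orbT.
  apply: (@sub_in_pairwise _ (mem s) (cosets_distinct (@centre G))) => [||//];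
    last by apply/allP => g gs.
  move=> g h gs hs /asboolP gh; apply/asboolP => x y Ax Ay gxhy.
  have : exists f, ~ commute (g^-1 * h)%g f.
    apply: contrapT => nf; apply: gh => f; apply: contrapT => fgh; apply: nf.
    by exists f.
  move=> /(xgetPex 1%g); rewrite -/(w g h); apply.
  have -> : (g^-1 * h = x * y^-1)%g by rewrite -(mulKg g x) gxhy -!mulgA mulgV mulg1.
  have [_ [CM CV]] := centralizer_of_subgroup [set` F].
  by apply: (CM _ _ Ax (CV _ Ay)); exact: (allpairs_f w).
have half x : ~ A x -> mass (mu n) (centralizer_of [set x]) <= 1 / 2 + eps.
  move=> nAx; have [f fF nxf] : exists2 f, f \in F & ~ commute x f.
    apply: contrapT => nf; apply: nAx => f fF; apply: contrapT => xf.
    by apply: nf; exists f.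
  suff : 2 * mass (mu n) (centralizer_of [set x]) <= 1 + 2 * eps by lra.
  apply: (mass_disjoint_lcosets (nuP n) (s := [:: 1%g; f])).
    by move=> b; rewrite !inE => /orP[]/eqP ->; apply: dist;
      rewrite ?mem_head// inE mem_cat fF orbT.
  rewrite /= !andbT; apply/asboolP => y z Cy Cz; rewrite mul1g => yfz; apply: nxf.
  have -> : f = (y * z^-1)%g by rewrite yfz mulgK.
  by apply: commuteM; [|apply: commuteV]; apply/commute_sym; [exact: Cy|exact: Cz].
have c01 : 0 <= 1 / 2 + eps <= 1 by apply/andP; split; lra.
have := le_trans dcn (dc_le (nuP n) c01 half); rewrite lee_fin.
set m := mass _ _ in Am *; set k := (size s)%:R in Am *.
have k0 : 0 < k by rewrite ltr0n.
have Am' : m <= k^-1 + eps.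
  by rewrite -(ler_pM2l k0) mulrDr divff ?gt_eqF.
have -> : (2 * k)^-1 = k^-1 / 2 by rewrite invfM mulrC.
have m0 : 0 <= m := mass_ge0 (nuP n) A.
nra.
Qed.

(** With [k] the integer part of [eps^-1], having [k.+1] distinct cosets would force
    [eps <= (2 * k.+1)^-1], against [k.+1 > eps^-1]. *)
Lemma dcM_centre_index (eps : R) : 0 < eps -> ((1 / 2 + eps)%:E <= dcM mu)%E ->
  exists k : nat, k%:R <= eps^-1 /\ index_le (@centre G) k.
Proof.
move=> eps0 epsM; exists (Num.truncn eps^-1); split.
  by rewrite truncn_le invr_ge0 ltW.
apply: contrapT => /(not_index_le_cosets (centre_subgroup G))[s sk ps].
have s0 : (0 < size s)%N by rewrite sk.
have := dcM_le_centre_cosets s0 ps epsM.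
rewrite sk lerD2l invfM => le_eps.
have := truncnS_gt eps^-1; set k := (Num.truncn eps^-1).+1%:R in le_eps *.
have k0 : 0 < k by rewrite ltr0n.
have := ler_wpM2l (ltW k0) le_eps.
rewrite mulrCA divff ?gt_eqF// mulr1 => keps.
rewrite -(ltr_pM2r eps0) mulVf ?gt_eqF//; lra.
Qed.

(** If [x] and [y] do not commute, then 1, [x], [y] and [x * y] lie in four distinct cosets of the
    centre, giving the bound [1/2 + 1/8]. *)
Lemma dcM_abelian : ((5 / 8 : R)%:E < dcM mu)%E -> grp_abelian G.
Proof.
move=> dcM58.
have [beta beta58 betaM] : exists2 beta : R, 5 / 8 < beta & (beta%:E <= dcM mu)%E.
  case: (dcM mu) dcM58 => [r| |] //=; first by rewrite lte_fin => ?; exists r.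
  by move=> _; exists 1; [lra|exact: leey].
move=> x y; apply: contrapT => nxy.
have := @dcM_le_centre_cosets beta [:: 1; x; y; x * y]%g erefl _ betaM.
move=> H; suff : beta <= 1 / 2 + (2 * 4)^-1 by lra.
apply: H => /=; rewrite !andbT.
have nC z t : ~ (z * t = t * z)%g -> ~ (@centre G) z by move=> nzt /(_ t).
have nyx : ~ (y * x = x * y)%g by move=> yx; apply: nxy.
apply/and3P; split; [apply/and3P; split|apply/andP; split|];
  apply/asboolP; rewrite ?invg1 ?mul1g.
- exact: nC nxy.
- exact: nC nyx.
- by apply: (nC _ y) => /(congr1 (fun t => t * y^-1)%g); rewrite mulgK mulgA mulgK.
- apply: (nC _ x) => /(congr1 (fun t => x * t)%g).
  by rewrite !mulgA mulgV mul1g mulgK.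
- by rewrite mulKg; exact: nC nyx.
- apply: (nC _ y) => /(congr1 (fun t => y * t)%g).
  by rewrite !mulgA mulgV mul1g mulgK => /mulIg.
Qed.

End CommutingProbability.

(** * Positive commuting probability *)

Lemma fact_le_exp n : (n`! <= n ^ n)%N.
Proof.
suff: forall m, (m <= n)%N -> (m`! <= n ^ m)%N by apply.
elim=> [|m IHm] mn; first by rewrite fact0.
by rewrite factS expnS leq_mul// IHm// ltnW.
Qed.

(** Combines [q! <= q ^ q] with [q <= expR q]. *)
Lemma fact_exp_le_expR (R : realType) (q : nat) :
  ((q`! ^ q)%N%:R : R) <= expR (q%:R ^+ 3).
Proof.
apply: (@le_trans _ _ ((q ^ q) ^ q)%N%:R).
  by rewrite ler_nat; case: q => // q; rewrite leq_exp2r// fact_le_exp.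
have -> : (q%:R ^+ 3 : R) = (q * q)%N%:R * q%:R by rewrite natrM; ring.
rewrite expRM_natl -expnM natrX; apply: lerXn2r; rewrite ?nnegrE ?expR_ge0//.
by apply: le_trans (expR_ge1Dx _); rewrite lerDr.
Qed.

Section FewConjugates.
Variables (G : groupType) (K : nat).
Implicit Types (x g : G).

Definition few_conjugates : set G := [set x | index_le (centralizer_of [set x]) K].

Lemma few_conjugates1 : (0 < K)%N -> few_conjugates 1%g.
Proof.
move=> K0; exists [:: 1%g]; split=> // x; exists 1%g; first exact: mem_head.
by move=> _ ->; exact: commute1.
Qed.

Lemma few_conjugatesV x : few_conjugates x -> few_conjugates x^-1%g.
Proof.
move=> [s [sK sG]]; exists s; split=> // y; have [g gs /(_ x erefl) gy] := sG y.
by exists g => // _ ->; exact: commuteV.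
Qed.

Lemma few_conjugatesJ x g : few_conjugates x -> few_conjugates (x ^ g)%g.
Proof.
move=> [s [sK sG]]; exists [seq (h ^ g)%g | h <- s]; rewrite size_map; split=> // y.
have [h hs /(_ x erefl) hy] := sG (y ^ g^-1)%g.
exists (h ^ g)%g; first exact: map_f.
have -> : ((h ^ g)^-1 * y = (h^-1 * y ^ g^-1) ^ g)%g by rewrite conjMg conjVg conjgKV.
by move=> _ ->; rewrite /commute -!conjMg hy.
Qed.

End FewConjugates.

Section PositiveCommutingProbability.
Variables (R : realType) (G : groupType) (mu : nat -> G -> R).
Hypothesis mu_inv : almost_invariant mu.
Variable gens : seq G.
Hypothesis gensG : forall x H, is_subgroup H -> [set` gens] `<=` H -> H x.

(** With [N.+1] disjoint translates the exceptional set has mass about [1/(N+1)] at most. The choice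
    of [K] makes other centralizers contribute about [1/K], half of the gap [d = 1/N - 1/(N+1)], so
    the total stays below [1/N]. *)
Lemma few_conjugates_translates (alpha : R) (N : nat) (s : seq G) :
  (0 < N)%N -> N%:R^-1 <= alpha -> (alpha%:E <= dcM mu)%E ->
  pairwise (lcosets_disjoint (few_conjugates (2 * (N * N.+1)))) s -> (size s <= N)%N.
Proof.
move=> N0 Nalpha alphaM ps; rewrite leqNgt; apply/negP => Ns.
have {ps} := subseq_pairwise (take_subseq s N.+1) ps.
have : size (take N.+1 s) = N.+1 by rewrite size_takel.
move: (take _ _) => {Ns}s sN ps.
set K := (2 * _)%N in ps; set X := few_conjugates K in ps.
pose n : R := N%:R; pose d := (n * (n + 1))^-1.
have n1 : 1 <= n by rewrite ler1n.
have nn0 : 0 < n * (n + 1) by nra.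
have d0 : 0 < d by rewrite invr_gt0.
have d_half : d <= 1 / 2 by rewrite div1r lef_pV2 ?posrE//; nra.
(* Three errors of size [eps] must fit into the remaining [d / 2]. *)
pose eps := d / 12.
have eps0 : 0 < eps by rewrite divr_gt0.
pose S := gens ++ [seq x^-1%g | x <- gens].
have SV : {in S, forall t, t^-1%g \in S}.
  move=> t; rewrite !mem_cat => /orP[tg|/mapP[u ug ->]].
    by rewrite map_f ?orbT.
  by rewrite invgK ug.
have SG x H : is_subgroup H -> [set` S] `<=` H -> H x.
  by move=> HG SH; apply: gensG => // t tg; apply: SH; rewrite /= mem_cat tg.
(* One finite ball supplies the translating elements for every [x] outside [X] at once, so a single
   index [i] serves them all. *)
have [i dci dist] := dcM_almost_attained [seq b^-1%g | b <- ball S K ++ s] mu_inv alphaM eps0.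
have {}dist : {in ball S K ++ s, forall b,
    (l1dist (translate b^-1 (mu i)) (mu i) <= eps%:E)%E}.
  by move=> b bB; apply: dist; exact: map_f.
have nuP : is_prob (mu i) by have [] := mu_inv.
have X_le : (n + 1) * mass (mu i) X <= 1 + (n + 1) * eps.
  rewrite natr1 -sN; apply: mass_disjoint_lcosets => //.
  by move=> b bs; apply: dist; rewrite mem_cat bs orbT.
have few x : ~ X x -> mass (mu i) (centralizer_of [set x]) <= d / 2 + eps.
  move=> nX; have CG := centralizer_of_subgroup [set x].
  have [t [tK tball pt]] := ball_cosets CG SV SG nX.
  have [_ [CM CV]] := CG.
  have := @mass_disjoint_lcosets _ _ _ nuP (centralizer_of [set x]) t eps.
  rewrite tK => t_le.
  have {t_le} : K.+1%:R * mass (mu i) (centralizer_of [set x]) <= 1 + K.+1%:R * eps.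
    apply: t_le; first by move=> b /tball bB; apply: dist; rewrite mem_cat bB.
    apply: cosets_lcosets_disjoint pt => a b Ca Cb.
    exact: (CM _ _ Ca (CV _ Cb)).
  set p := K.+1%:R; have pE : p = 2 * (n * (n + 1)) + 1.
    by rewrite /p -[K.+1%:R]natr1 /K !natrM -[N.+1%:R]natr1.
  have p0 : 0 < p by nra.
  move=> H; apply: (@le_trans _ _ (p^-1 + eps)).
    by rewrite -(ler_pM2l p0) mulrDr divff ?gt_eqF.
  rewrite lerD2r /d -invfM mulrC lef_pV2 ?posrE//; nra.
have c01 : 0 <= d / 2 + eps <= 1 by rewrite /eps; apply/andP; split; lra.
have := le_trans dci (dc_le nuP c01 few); rewrite lee_fin.
have m0 : 0 <= mass (mu i) X := mass_ge0 nuP X.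
have Xle : mass (mu i) X <= (n + 1)^-1 + eps.
  have n10 : 0 < n + 1 by lra.
  by rewrite -(ler_pM2l n10) mulrDr divff ?gt_eqF.
have nE : n^-1 = (n + 1)^-1 + d by rewrite /d; field; apply/andP; split; rewrite gt_eqF//; lra.
have c0 : 0 <= d / 2 + eps by lra.
have := mulr_ge0 c0 m0.
have epsE : eps = d / 12 by [].
by rewrite -/n in Nalpha; move: m0 Xle nE epsE Nalpha d0; clearbody eps d; lra.
Qed.

Lemma dcM_le1 (alpha : R) : (alpha%:E <= dcM mu)%E -> alpha <= 1.
Proof.
move=> alphaM; apply/ler_addgt0Pr => e e0.
have [i dci _] := dcM_almost_attained [::] mu_inv alphaM e0.
have nuP : is_prob (mu i) by have [] := mu_inv.
have c01 : 0 <= (0 : R) <= 1 by rewrite lexx ler01.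
have := le_trans dci (@dc_le _ _ _ nuP setT 0 c01 (fun x nx => False_ind _ (nx I))).
by rewrite lee_fin massT//; lra.
Qed.

(** Here [k] equals the ceiling, so that the bound on [q] in terms of [k] becomes one in terms of
    [alpha]. *)
Lemma dcM_bounded_by_abelian_by_bounded (alpha : R) :
  0 < alpha -> (alpha%:E <= dcM mu)%E ->
  exists (Gamma H : set G) (k : nat),
    [/\ is_normal Gamma, is_normal H, H `<=` Gamma,
        k%:Z = Num.ceil alpha^-1 & index_le Gamma k] /\
    (exists q, (q <= 4 * (k * k) * (39 * (k * k * (k * k)) * (13 * (k * k * k))))%N /\
       finite_card_le H (expR (q%:R ^+ 3 : R))) /\
    quotient_abelian Gamma H.
Proof.
move=> alpha0 alphaM; pose N := `|Num.ceil alpha^-1|%N.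
have ceil0 : 0 < Num.ceil alpha^-1 by rewrite ceil_gt0 invr_gt0.
have NE : N%:Z = Num.ceil alpha^-1 by rewrite /N gez0_abs// ltW.
have N0 : (0 < N)%N by rewrite -ltz_nat NE.
have Nalpha : N%:R^-1 <= alpha.
  rewrite -[leRHS]invrK lef_pV2 ?posrE ?ltr0n ?invr_gt0//.
  by have := ceil_ge alpha^-1; rewrite -NE.
pose K := (2 * (N * N.+1))%N; pose X : set G := few_conjugates K.
have K0 : (0 < K)%N by rewrite !muln_gt0 N0.
have X1 : X 1%g by exact: few_conjugates1.
have XV x : X x -> X x^-1%g by exact: few_conjugatesV.
have XJ x g : X x -> X (x ^ g)%g by exact: few_conjugatesJ.
have disjN s : pairwise (lcosets_disjoint X) s -> (size s <= N)%N.
  exact: few_conjugates_translates Nalpha alphaM.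
pose Gam := set_power X (3 * N).
have stable m : set_power X m `<=` Gam by exact: set_power_stable.
have GamG : is_subgroup Gam.
  split; first exact/stable/set_power0.
  by split=> [x y Gx Gy|x]; [exact: stable (set_powerM Gx Gy)|exact: set_powerV].
have GamJ g x : Gam x -> Gam (x ^ g)%g by apply: set_powerJ => // y; exact: XJ.
have XGam : X `<=` Gam by move=> x /set_power1/stable.
pose H := commutator_products Gam.
exists Gam, H, N; split; last split; last first.
- move=> x y Gx Gy; have := mem_commutator_products Gx Gy.
  by rewrite commgEl conjgE !mulgA.
- have [q [s [qK Hs sq]]] := @commutator_products_card G X K (fun x Xx => Xx) XJ
    Gam GamG XGam (3 * N)%N (fun g Gg => Gg).
  exists q; split.
    (* With [r = 3N] and [K <= 4N^2] one has [K r <= 12N^3], hence [r + K r r <= 39N^4] and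
       [1 + K r <= 13N^3]. *)
    apply: leq_trans qK _; rewrite /K.
    have N1 : (1 <= N * N * N)%N by rewrite !muln_gt0 N0.
    have KN : (2 * (N * N.+1) <= 4 * (N * N))%N by nia.
    have NK : (2 * (N * N.+1) * (3 * N) <= 12 * (N * N * N))%N.
      by apply: leq_trans (leq_mul KN (leqnn _)) _; nia.
    apply: leq_mul => //; apply: leq_mul; last by nia.
    have := leq_mul NK (leqnn (3 * N)%N); nia.
  by exists s; split=> //; rewrite sq; exact: fact_exp_le_expR.
- split=> //.
  + by split=> // g h /(GamJ g); rewrite conjgE mulgA.
  + split; first exact: commutator_products_subgroup.
    move=> g h; rewrite -mulgA -conjgE.
    by apply: commutator_productsJ => x; exact: GamJ.
  + apply: gen_subgroup_min => // _ [x Gx [y Gy <-]].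
    have [_ [GM GV]] := GamG; rewrite commgEl; apply: GM; first exact: GV.
    exact: subgroupJ.
  (* Since [X] lies in [Gam], distinct cosets of [Gam] give disjoint translates of [X]. *)
  + apply: contrapT => /(not_index_le_cosets GamG)[s sN ps].
    have := disjN s; rewrite sN ltnn => nps; apply: notF; apply: nps.
    apply: cosets_lcosets_disjoint ps => x y /XGam Gx /XGam Gy.
    by have [_ [GM GV]] := GamG; apply: GM => //; exact: GV.
Qed.

End PositiveCommutingProbability.

(** * Explicit constants and the final statement *)

(** Cubing gives [x^3 <= c^3 b^27 alpha^-27]; the hypotheses on [c] and [b] force [C >= 27], so the
    same [C] serves as factor and as exponent. *)
Lemma expR_cube_le_powR (R : realType) (alpha x n b c C : R) :
  0 < alpha <= 1 -> 0 <= x <= c * n ^+ 9 -> 0 <= n <= b * alpha^-1 ->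
  27 <= c -> 1 <= b -> c ^+ 3 * b ^+ 27 <= C ->
  expR (x ^+ 3) <= expR (C * alpha `^ (- C)).
Proof.
move=> /andP[alpha0 alpha1] /andP[x0 xc] /andP[n0 nb] c27 b1 bC; rewrite ler_expR.
have Va0 : 0 <= alpha^-1 by rewrite invr_ge0 ltW.
have Va1 : 1 <= alpha^-1 by rewrite invf_ge1.
have c0 : 0 <= c by lra.
have c1 : 1 <= c by lra.
have b0 : 0 <= b by lra.
have C27 : 27 <= C.
  apply: le_trans bC; apply: le_trans c27 _.
  apply: le_trans (ler_eXnr (ltn0Sn 2) c1) _.
  by rewrite ler_peMr ?exprn_ege1 ?exprn_ge0.
apply: (@le_trans _ _ (c ^+ 3 * b ^+ 27 * alpha^-1 ^+ 27)).
  rewrite -mulrA -exprMn; apply: (@le_trans _ _ ((c * n ^+ 9) ^+ 3)).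
    by apply: lerXn2r; rewrite ?nnegrE// mulr_ge0 ?exprn_ge0.
  rewrite [leLHS]exprMn -[_ ^+ 9 ^+ 3]exprM; apply: ler_wpM2l; first exact: exprn_ge0.
  by apply: lerXn2r; rewrite ?nnegrE// mulr_ge0.
have -> : alpha `^ (- C) = alpha^-1 `^ C.
  by rewrite -powR_inv1 ?ltW// -powRrM mulN1r.
apply: ler_pM => //.
- by rewrite mulr_ge0 ?exprn_ge0.
- exact: exprn_ge0.
- by rewrite -powR_mulrn//; exact: ler_powR.
Qed.

Lemma natr_ceil_le (R : realType) (x : R) (N : nat) :
  1 <= x -> N%:Z = Num.ceil x -> N%:R <= 2 * x.
Proof.
move=> x1 NE; have := ceilB1_lt x; rewrite -NE rmorphB/= => NV.
have N1 : N%:~R <= x + 1 by lra.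
by apply: le_trans N1 _; lra.
Qed.

Theorem theorem1p7 (R : realType) :
  exists C : R, 0 < C /\
  forall (G : groupType) (mu : nat -> G -> R),
    countable [set: G] -> amenable R G -> almost_invariant mu ->
    [/\ (((5 / 8 : R)%:E < dcM mu)%E -> grp_abelian G),
        ((forall eps : R, 0 < eps -> ((1 / 2 + eps)%:E <= dcM mu)%E ->
           exists k : nat, k%:R <= eps^-1 /\ index_le (@centre G) k))
      & ((forall alpha : R, 0 < alpha -> finitely_generated G ->
           (alpha%:E <= dcM mu)%E ->
           exists (Gamma H : set G) (k : nat),
             [/\ is_normal Gamma, is_normal H, (H `<=` Gamma),
                 (k%:Z <= Num.ceil (alpha^-1)) & index_le Gamma k] /\
             finite_card_le H (expR (C * (alpha `^ (- C)))) /\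
             quotient_abelian Gamma H))].
Proof.
have [c [b [c27 b1 cE ceil_b]]] : exists c b : R, [/\ 27 <= c, 1 <= b,
    forall n, 4 * (n * n) * (39 * (n * n * (n * n)) * (13 * (n * n * n))) = c * n ^+ 9 &
    forall (x : R) (N : nat), 1 <= x -> N%:Z = Num.ceil x -> N%:R <= b * x].
  (* [2028 = 4 * 39 * 13], and 2 bounds the ratio of the ceiling of [x] to [x] when [x >= 1]. *)
  exists 2028, 2; split; [by lra|by lra|by move=> n; ring|exact: natr_ceil_le].
exists (c ^+ 3 * b ^+ 27); split; first by rewrite mulr_gt0 ?exprn_gt0//; lra.
move=> G mu _ _ mu_inv; split; first exact: dcM_abelian.
  by move=> eps; exact: dcM_centre_index.
move=> alpha alpha0 [gens gensG] alphaM.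
have gensG' x H : is_subgroup H -> [set` gens] `<=` H -> H x by exact: gensG.
have [Gam [H [k [[nGam nH HG kE kG] [[q [qk [s [Hs sq]]]] ab]]]]] :=
  dcM_bounded_by_abelian_by_bounded mu_inv gensG' alpha0 alphaM.
exists Gam, H, k; split; first by split=> //; rewrite kE.
split=> //; exists s; split=> //; apply: le_trans sq _.
have alpha1 := dcM_le1 mu_inv alphaM.
apply: (expR_cube_le_powR (n := k%:R) _ _ _ c27 b1 (lexx _)).
- by rewrite alpha0.
- by rewrite ler0n -cE -!natrM ler_nat.
- by rewrite ler0n ceil_b// invf_ge1.
Qed.
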